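(* Let $G$ be a compact Hausdorff topological group, and let $A$ be a $G$-homotopy dense subset of a $G$-space $X$. If $X$ is a $G$-ANR, then $A$ is also a $G$-ANR.
   Context: $G$ is a compact Hausdorff topological group. All spaces are completely regular and Hausdorff, and all maps are continuous. A $G$-space is a space with a continuous action of $G$; a $G$-map is a continuous map $f$ with $f(gx)=gf(x)$ for all $g\in G$ and all $x$. A subset $S$ of a $G$-space is invariant if $gs\in S$ for all $g\in G$, $s\in S$. A metrizable $G$-space is a $G$-space whose underlying space is metrizable. $G$-ANR: a metrizable $G$-space $Y$ is a $G$-ANR if for every closed $G$-embedding $Y\hookrightarrow Z$ in a metrizable $G$-space $Z$ there exist an invariant neighborhood $U$ of $Y$ in $Z$ and a $G$-retraction $r:U\to Y$ (i.e. a $G$-map that is the identity on $Y$). (In particular, a $G$-ANR is metrizable.) $G$-homotopy: with $I=[0,1]$, a $G$-homotopy is a continuous map $F:X\times I\to Y$ that is a $G$-map for the action $g(x,t)=(gx,t)$ on $X\times I$; write $F_t(x)=F(x,t)$. $G$-homotopy dense: an invariant subset $A$ of a $G$-space $X$ is $G$-homotopy dense in $X$ if there exists a $G$-homotopy $F:X\times I\to X$ with $F_0=\mathrm{id}_X$ and $F_t(X)\subset A$ for every $t\in(0,1]$. *)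

(* Defs.v *)
From HB Require Import structures.
From mathcomp Require Import all_boot all_order all_algebra.
From mathcomp Require Import all_classical all_reals all_analysis.
Set Implicit Arguments.
Unset Strict Implicit.
Unset Printing Implicit Defensive.
Import Order.TTheory GRing.Theory Num.Theory.
Import numFieldNormedType.Exports.

Local Open Scope classical_set_scope.
Local Open Scope ring_scope.

HB.mixin Record isTopologicalGroup G of Topological G & Group G := {
  mulg_continuous : continuous (fun p : G * G => (p.1 * p.2)%g) ;
  invg_continuous : continuous (fun g : G => (g^-1)%g)
}.

#[short(type="topologicalGroupType")]
HB.structure Definition TopologicalGroup :=
  {G of Topological G & Group G & isTopologicalGroup G}.

(* No separation axiom is part of the structure: "completely regular and
   Hausdorff" is an explicit hypothesis where it is needed, and is automatic
   for the metrizable spaces that the definition of G-ANRs is about. *)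
HB.mixin Record isGSpace (G : topologicalGroupType) X of Topological X := {
  act : G -> X -> X ;
  act1 : forall x, act 1%g x = x ;
  actM : forall g h x, act (g * h)%g x = act g (act h x) ;
  act_continuous : continuous (fun p : G * X => act p.1 p.2)
}.

#[short(type="gSpaceType")]
HB.structure Definition GSpace (G : topologicalGroupType) :=
  {X of Topological X & isGSpace G X}.

Section GSpaces.
Context {G : topologicalGroupType}.
Implicit Types X Y : gSpaceType G.

Definition g_invariant X (S : set X) :=
  forall (g : G) (s : X), S s -> S (act g s).

Definition g_map X Y (f : X -> Y) :=
  continuous f /\ forall (g : G) (x : X), f (act g x) = act g (f x).

(* An invariant subset with the subspace topology and the restricted action.
   The proof of invariance is an argument of the type, so that the action can be
   found by unification. *)
Definition g_subspace X (S : set X) of g_invariant S : Type := set_type S.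

Section subspace.
Context {X} {S : set X} (invS : g_invariant S).

HB.instance Definition _ := Topological.copy (g_subspace invS) (set_type S).

Definition sub_act (g : G) (s : g_subspace invS) : g_subspace invS :=
  exist _ (act g (set_val s)) (mem_set (invS g (set_valP s))).

Lemma sub_act1 s : sub_act 1%g s = s.
Proof. by apply: val_inj => /=; exact: act1. Qed.

Lemma sub_actM g h s : sub_act (g * h)%g s = sub_act g (sub_act h s).
Proof. by apply: val_inj => /=; exact: actM. Qed.

Lemma sub_act_continuous :
  continuous (fun p : G * g_subspace invS => sub_act p.1 p.2).
Proof.
apply/continuous_comp_initial.
have -> : set_val \o (fun p : G * g_subspace invS => sub_act p.1 p.2) =
    (fun p : G * X => act p.1 p.2) \o (fun p => (p.1, set_val p.2)) by [].
move=> p; apply: continuous_comp; last exact: act_continuous.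
apply: cvg_pair; first exact: cvg_fst.
apply: (@cvg_comp _ _ _ snd (set_val : set_type S -> X) _ (nbhs p.2)).
  exact: cvg_snd.
exact: (@initial_continuous (set_type S) X set_val p.2).
Qed.

HB.instance Definition _ := isGSpace.Build G (g_subspace invS)
  sub_act1 sub_actM sub_act_continuous.

End subspace.

End GSpaces.

Definition metrizable (R : realType) (T : topologicalType) :=
  exists (M : metricType R) (f : T -> M) (f' : M -> T),
    [/\ cancel f f', cancel f' f, continuous f & continuous f'].

(* The middle clause says that the topology of Y is the one induced by Z through
   i, so that i is a homeomorphism onto its image. *)
Definition closed_embedding (Y Z : topologicalType) (i : Y -> Z) :=
  [/\ injective i,
      forall U : set Y, open U <-> exists2 V, open V & U = i @^-1` V &
      closed (range i)].

(* Y is identified with its image range i, so that being the identity on Y reads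
   r (i y) = y for the retraction r. *)
Definition g_anr (R : realType) (G : topologicalGroupType)
    (Y : gSpaceType G) :=
  metrizable R Y /\
  forall (Z : gSpaceType G) (i : Y -> Z),
    metrizable R Z -> g_map i -> closed_embedding i ->
    exists (U : set Z) (invU : g_invariant U) (r : g_subspace invU -> Y),
      [/\ range i `<=` U°, g_map r &
          forall (y : Y) (u : g_subspace invU), set_val u = i y -> r u = y].

Definition unit_interval (R : realType) : topologicalType :=
  set_type (`[0, 1] : set R).

Definition g_homotopy (R : realType) (G : topologicalGroupType)
    (X Y : gSpaceType G) (F : X * unit_interval R -> Y) :=
  continuous F /\ forall (g : G) x t, F (act g x, t) = act g (F (x, t)).

Definition g_homotopy_dense (R : realType) (G : topologicalGroupType)
    (X : gSpaceType G) (A : set X) :=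
  g_invariant A /\
  exists F : X * unit_interval R -> X,
    [/\ g_homotopy F,
        forall x t, set_val t = 0 -> F (x, t) = x &
        forall x t, 0 < set_val t -> A (F (x, t))].

(* Main.v *)
(* Let A be closed in a metrizable G-space Z. It suffices to extend the inclusion
   of A into X to a G-map f from an invariant neighborhood of A in Z to X: with an
   invariant continuous function lam on Z that vanishes exactly on A, and F the
   homotopy that makes A dense, z |-> F (f z, lam z) then takes values in A and is
   the identity on A.

   To extend, glue Z to X along A. The quotient topology need not be metrizable,
   so the glued space W = X + (Z \ A) gets a coarser one, from a Kuratowski type
   embedding in bounded functions on W: the functions d(x, .) on A extend over Z,
   uniformly in x, by the explicit Tietze formula
     z |-> inf_a (d(x, a) + d(z, a) / d(z, A) - 1).
   With G-invariant metrics on X and Z the formula is equivariant, so G acts on W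
   by isometries, and X is closed in W. A G-retraction of a neighborhood of X
   in W, composed with Z -> W, is the extension. *)
Require Import Defs.
From HB Require Import structures.
From mathcomp Require Import all_boot all_order all_algebra.
From mathcomp Require Import all_classical all_reals all_analysis.
From mathcomp Require Import ring lra.
Set Implicit Arguments.
Unset Strict Implicit.
Unset Printing Implicit Defensive.
Import Order.TTheory GRing.Theory Num.Theory.
Import numFieldNormedType.Exports.
Local Open Scope classical_set_scope.
Local Open Scope ring_scope.

(** * Distances as plain functions, and metrizability in terms of them *)

Record is_dist (R : realType) (T : Type) (d : T -> T -> R) : Prop := {
  distxx : forall x, d x x = 0 ;
  dist_eq0 : forall x y, d x y = 0 -> x = y ;
  distC : forall x y, d x y = d y x ;
  dist_triangle : forall y x z, d x z <= d x y + d y z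
}.

Definition dist_topology (R : realType) (T : topologicalType)
    (d : T -> T -> R) :=
  forall (x : T) (U : set T),
    nbhs x U <-> exists2 e, 0 < e & forall y, d x y < e -> U y.

(** An alias of [T], so that the topology of [d] does not clash with one already on [T]; the proof
    is a parameter so that the structures can be inferred from the type. *)
Definition dist_space (R : realType) (T : choiceType) (d : T -> T -> R)
  of is_dist d : Type := T.

Section dist_space.
Context {R : realType} {T : choiceType} {d : T -> T -> R} (dP : is_dist d).

HB.instance Definition _ := Choice.on (dist_space dP).
HB.instance Definition _ := @isMetric.Build R (dist_space dP) d
  (distxx dP) (dist_eq0 dP) (distC dP) (dist_triangle dP).

Lemma dist_space_topology : dist_topology (d : dist_space dP -> _ -> R).
Proof.
move=> x U; split=> [/nbhs_ballP[e /= e0 xU]|[e e0 xU]].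
  by exists e => // y xy; apply: xU; rewrite ballEmdist.
by apply/nbhs_ballP; exists e => // y; rewrite ballEmdist; exact: xU.
Qed.

End dist_space.

Section dist.
Context {R : realType}.

Lemma dist_ge0 (T : Type) (d : T -> T -> R) x y : is_dist d -> 0 <= d x y.
Proof.
move=> dP; have := dist_triangle dP y x x.
by rewrite (distxx dP) (distC dP y x) -mulr2n pmulrn_lge0.
Qed.

Lemma dist_lip (T : Type) (d : T -> T -> R) x y z :
  is_dist d -> `|d x z - d y z| <= d x y.
Proof.
move=> dP; rewrite ler_norml; have := dist_triangle dP x y z.
have := dist_triangle dP y x z; rewrite (distC dP y x); lra.
Qed.

Lemma dist_continuous (S T : topologicalType) (dS : S -> S -> R)
    (dT : T -> T -> R) (f : S -> T) :
  dist_topology dS -> dist_topology dT ->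
  continuous f <-> forall x e, 0 < e ->
    exists2 r, 0 < r & forall y, dS x y < r -> dT (f x) (f y) < e.
Proof.
move=> tS tT; split=> [fc x e e0|fc x U].
  have /fc/tS[r r0 rP] : nbhs (f x) [set y | dT (f x) y < e].
    by apply/tT; exists e.
  by exists r.
move=> /tT[e e0 eU]; apply/tS; have [r r0 rP] := fc x e e0.
by exists r => // y /rP/eU.
Qed.

Lemma nbhs_dist (T : topologicalType) (d : T -> T -> R) x e :
  dist_topology d -> 0 < e -> \forall y \near x, d x y < e.
Proof. by move=> dT e0; apply/dT; exists e. Qed.

(** Pulling the metric back along the homeomorphism puts it on [T] itself, where it can be replaced
    by an invariant one. *)
Lemma metrizableP (T : topologicalType) :
  metrizable R T <-> exists2 d : T -> T -> R, is_dist d & dist_topology d.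
Proof.
split=> [[M [f [g [fK gK fc gc]]]]|[d dP dT]].
  exists (fun x y => mdist (f x) (f y)).
    split=> [x|x y /mdist_positivity/(can_inj fK)//|x y|y x z].
    - exact: mdistxx.
    - exact: metric_sym.
    - exact: metric_triangle.
  move=> x U; split=> [xU|[e e0 xU]].
    have /gc/nbhs_ballP[e /= e0 eU] : nbhs (g (f x)) U by rewrite fK.
    by exists e => // y xy; rewrite -[y]fK; apply: eU; rewrite ballEmdist.
  have := fc x _ (nbhsx_ballx (f x) e e0). rewrite nbhs_simpl.
  apply: (@filterS _ (nbhs x)) => y.
  by rewrite /= ballEmdist => /xU.
exists (dist_space dP), id, id; split=> // x U.
  by move=> /dist_space_topology/dT.
by move=> /dT/dist_space_topology.
Qed.

End dist.

(** * Distances pulled back from the supremum norm on bounded functions *)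

Section sup_dist.
Context {R : realType} {T J : Type} (Phi : T -> J -> R).

Definition sup_dist p q := sup (range (fun j => `|Phi p j - Phi q j|)).

Lemma sup_dist_le p q e :
  0 <= e -> (forall j, `|Phi p j - Phi q j| <= e) -> sup_dist p q <= e.
Proof.
move=> e0 pq; rewrite /sup_dist.
(* For empty [J] the supremum is that of [set0], which is 0 by default; this case rests on
   [0 <= e]. *)
have [->|/set0P ne] := eqVneq (range (fun j => `|Phi p j - Phi q j|)) set0.
  by rewrite sup0.
by apply: ge_sup => // _ [j _ <-].
Qed.

(** Since [v] is onto, both suprema run over the same set of values. *)
Lemma sup_dist_map (u : T -> T) (v v' : J -> J) p q :
  cancel v' v -> (forall p j, Phi (u p) (v j) = Phi p j) ->
  sup_dist (u p) (u q) = sup_dist p q.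
Proof.
move=> v'K uv; congr sup; apply/seteqP; split=> _ /= [j _ <-].
  by exists (v' j) => //; rewrite -!(uv _ (v' j)) v'K.
by exists (v j) => //; rewrite !uv.
Qed.

Hypothesis Phi01 : forall p j, 0 <= Phi p j <= 1.

Lemma sup_dist_ge j p q : `|Phi p j - Phi q j| <= sup_dist p q.
Proof.
apply: ub_le_sup; last by exists j.
exists 1 => _ [k _ <-]; have := Phi01 p k; have := Phi01 q k.
rewrite ler_norml; lra.
Qed.

Lemma sup_dist_ge0 p q : 0 <= sup_dist p q.
Proof.
rewrite /sup_dist.
have [->|/set0P[_ [j _ _]]] :=
    eqVneq (range (fun j => `|Phi p j - Phi q j|)) set0.
  by rewrite sup0.
by rewrite (le_trans _ (sup_dist_ge j p q)).
Qed.

Lemma sup_dist_le1 p q : sup_dist p q <= 1.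
Proof.
apply: sup_dist_le => // j; have := Phi01 p j; have := Phi01 q j.
rewrite ler_norml; lra.
Qed.

Lemma sup_distP : injective Phi -> is_dist sup_dist.
Proof.
move=> Phi_inj; split=> [x|x y xy|x y|y x z].
- apply/eqP; rewrite eq_le sup_dist_ge0 andbT.
  by apply: sup_dist_le => // j; rewrite subrr normr0.
- apply/Phi_inj/funext => j; apply/eqP; rewrite -subr_eq0 -normr_le0 -xy.
  exact: sup_dist_ge.
- by congr sup; apply: eq_imagel => j _; rewrite distrC.
- apply: sup_dist_le => [|j]; first by rewrite addr_ge0 ?sup_dist_ge0.
  rewrite (le_trans (ler_distD (Phi y j) _ _))// lerD//; exact: sup_dist_ge.
Qed.

End sup_dist.

(** * Invariant metrics for actions of a compact group *)

Lemma compact_uniform (G X : topologicalType) (P : G -> X -> Prop) (x : X) :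
  compact [set: G] -> (forall g : G, nbhs (g, x) [set p | P p.1 p.2]) ->
  \forall y \near x, forall g, P g y.
Proof.
move=> /compact_near_coveringP cG gx.
have : \forall y \near x, [set: G] `<=` P^~ y.
  apply: cG => g _; have [[U V] /= [gU xV] UV] := gx g.
  by exists (U, V) => // -[h y] /= [hU yV]; exact: (UV (h, y)).
by apply: filterS => y yP g; exact: yP.
Qed.

Lemma orbit_continuous (G : topologicalGroupType) (X : gSpaceType G) (x : X) :
  continuous (fun g : G => act g x).
Proof.
move=> g; apply: (@cvg_comp _ _ _ (fun h => (h, x))
    (fun p : G * X => act p.1 p.2) (nbhs g) (nbhs (g, x))).
  by apply: cvg_pair; [exact: cvg_id|exact: cvg_cst].
exact: (@act_continuous G X (g, x)).
Qed.

(** The coordinates of [x] are the truncated distances from the points of its orbit to all [z].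
    Translating by [g] only reindexes them, whence invariance. The coordinate at [(1, x)] controls
    [m] near [x]; conversely, the tube lemma [compact_uniform] makes continuity of the action at [x]
    uniform over the group. *)
Lemma invariant_dist (R : realType) (G : topologicalGroupType)
    (X : gSpaceType G) : compact [set: G] -> metrizable R X ->
  exists d : X -> X -> R, [/\ is_dist d, dist_topology d,
    forall x y, d x y <= 1 & forall g x y, d (act g x) (act g y) = d x y].
Proof.
move=> cG /metrizableP[m mP mT].
pose Phi (x : X) (j : G * X) := Num.min 1 (m (act j.1 x) j.2).
have Phi01 p j : 0 <= Phi p j <= 1.
  by rewrite /Phi le_min ge_min lexx ler01 (dist_ge0 _ _ mP).
have Phi1 x y : Phi x (1%g, y) = Num.min 1 (m x y) by rewrite /Phi/= act1.
exists (sup_dist Phi); split.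
- apply: sup_distP => // x y xy; apply: (dist_eq0 mP).
  have := Phi1 x y; rewrite xy Phi1 (distxx mP).
  by case: (leP 1 (m x y)) => ?; case: (leP 1 (0:R)) => ? ?; lra.
- move=> x U; split=> [/mT[e e0 eU]|[e e0 eU]].
    exists (Num.min 1 e); first by rewrite lt_min ltr01.
    move=> y /(le_lt_trans (sup_dist_ge Phi01 (1%g, x) x y)).
    rewrite !Phi1 (distxx mP) => xy; apply: eU; move: xy.
    rewrite lt_min (distC mP x) !ltr_norml => /andP[].
    by case: (leP 1 (m y x)) => ?; case: (leP 1 (0:R)) => ? ?; lra.
  have : \forall y \near x, forall g, m (act g x) (act g y) < e / 2.
    apply: (compact_uniform (P := fun g y => m (act g x) (act g y) < e / 2)) => //.
    move=> g; have e4 : 0 < e / 4 by lra.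
    have gx : nbhs (g, x) [set p | m (act g x) (act p.1 p.2) < e / 4].
      exact: (@act_continuous G X (g, x) _ (nbhs_dist _ mT e4)).
    have : nbhs (g, x) [set p : G * X | m (act g x) (act p.1 x) < e / 4].
      have gx1 : (fun p : G * X => act p.1 x) @ (g, x) --> act g x.
        apply: (@cvg_comp _ _ _ fst (fun h => act h x) (nbhs (g, x)) (nbhs g)).
          exact: cvg_fst.
        exact: orbit_continuous.
      exact: (gx1 _ (nbhs_dist _ mT e4)).
    apply: filterS2 gx => p /= pg px.
    have := dist_triangle mP (act g x) (act p.1 x) (act p.1 p.2).
    rewrite (distC mP (act p.1 x) (act g x)); lra.
  apply: filterS => y xy; apply: eU.
  apply: (@le_lt_trans _ _ (e / 2)); last lra.
  apply: sup_dist_le => [|[g z]]; first lra.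
  rewrite /Phi/=; have := dist_lip (act g x) (act g y) z mP.
  move: (xy g); set a := m _ z; set b := m _ z; rewrite !ler_norml.
  by case: (leP 1 a) => ?; case: (leP 1 b) => ?; lra.
- by move=> x y; exact: sup_dist_le1.
- move=> g x y.
  apply: (@sup_dist_map _ _ _ _ _ (fun j => ((j.1 * g^-1)%g, j.2))
    (fun j => ((j.1 * g)%g, j.2))) => [[h z]|p [h z]] /=.
    by rewrite mulgK.
  by rewrite /Phi/= -actM mulgVK.
Qed.

(** * G-spaces from isometric actions *)

Record is_isometric_action (R : realType) (G : topologicalGroupType) (T : Type)
    (d : T -> T -> R) (a : G -> T -> T) : Prop := {
  isom_act1 : forall x, a 1%g x = x ;
  isom_actM : forall g h x, a (g * h)%g x = a g (a h x) ;
  isom_act_dist : forall g x y, d (a g x) (a g y) = d x y ;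
  isom_act_cvg : forall g x e, 0 < e -> \forall h \near g, d (a g x) (a h x) < e
}.

Definition dist_gspace (R : realType) (G : topologicalGroupType)
  (T : choiceType) (d : T -> T -> R) (a : G -> T -> T) (dP : is_dist d)
  of is_isometric_action d a : Type := dist_space dP.

Section dist_gspace.
Context {R : realType} {G : topologicalGroupType} {T : choiceType}.
Context {d : T -> T -> R} {a : G -> T -> T}.
Context (dP : is_dist d) (aP : is_isometric_action d a).

HB.instance Definition _ := Topological.copy (dist_gspace dP aP) (dist_space dP).

Let dist_gspace_act (g : G) (x : dist_gspace dP aP) : dist_gspace dP aP := a g x.

Let dist_gspace_act1 x : dist_gspace_act 1%g x = x.
Proof. exact: isom_act1 aP x. Qed.

Let dist_gspace_actM g h x :
  dist_gspace_act (g * h)%g x = dist_gspace_act g (dist_gspace_act h x).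
Proof. exact: isom_actM aP g h x. Qed.

(** Going through [a h x], isometry reduces joint continuity to that of the orbit maps. *)
Let dist_gspace_act_continuous :
  continuous (fun p : G * dist_gspace dP aP => dist_gspace_act p.1 p.2).
Proof.
move=> [g x] U /dist_space_topology[e e0 eU].
have e2 : 0 < e / 2 by lra.
exists ([set h | d (a g x) (a h x) < e / 2], [set y | d x y < e / 2]).
  split; first exact: (isom_act_cvg aP).
  by apply/dist_space_topology; exists (e / 2).
move=> [h y] /= [gh xy]; apply: eU => /=.
rewrite (le_lt_trans (dist_triangle dP (a h x) _ _))// [ltRHS]splitr.
by rewrite ltrD// (isom_act_dist aP).
Qed.

HB.instance Definition _ := isGSpace.Build G (dist_gspace dP aP)
  dist_gspace_act1 dist_gspace_actM dist_gspace_act_continuous.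

Lemma dist_gspace_topology : dist_topology (d : dist_gspace dP aP -> _ -> R).
Proof. exact: dist_space_topology. Qed.

End dist_gspace.

(** * Infima over a range, closed embeddings, and the distance to a closed image *)

Section range_inf.
Context {R : realType} {Y : Type} (F : Y -> R).

Lemma range_inf_le c y : (forall y, c <= F y) -> inf (range F) <= F y.
Proof. by move=> cF; apply: ge_inf; [exists c => _ [z _ <-]|exists y]. Qed.

Lemma range_inf_ge c (y : Y) : (forall y, c <= F y) -> c <= inf (range F).
Proof. by move=> cF; apply: lb_le_inf; [exists (F y), y|move=> _ [z _ <-]]. Qed.

Lemma range_inf_lt c (y : Y) : inf (range F) < c -> exists y, F y < c.
Proof.
move=> cF; apply/not_existsP => nF; move: cF; apply/negP; rewrite -leNgt.
by apply: range_inf_ge => // z; rewrite leNgt; apply/negP/nF.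
Qed.

Lemma range_inf_map (v v' : Y -> Y) (F' : Y -> R) :
  cancel v' v -> (forall y, F' (v y) = F y) -> inf (range F') = inf (range F).
Proof.
move=> v'K vF; congr inf; apply/seteqP; split=> _ /= [y _ <-].
  by exists (v' y) => //; rewrite -vF v'K.
by exists (v y).
Qed.

End range_inf.

Lemma closed_embedding_dist (R : realType) (Y Z : topologicalType) (i : Y -> Z)
    (d : Z -> Z -> R) : closed_embedding i -> dist_topology d ->
  forall (y : Y) (U : set Y), nbhs y U ->
    exists2 e, 0 < e & forall y', d (i y) (i y') < e -> U y'.
Proof.
move=> [_ iE _] dT y U; rewrite nbhsE => -[V [/iE[W oW WV] Vy] VU].
have : nbhs (i y) W.
  by apply: open_nbhs_nbhs; split=> //; move: Vy; rewrite WV.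
by move=> /dT[e e0 eW]; exists e => // y' /eW Wy'; apply: VU; rewrite WV.
Qed.

Lemma isometric_closed_embedding (R : realType) (S T : topologicalType)
    (dS : S -> S -> R) (dT : T -> T -> R) (j : S -> T) :
  is_dist dS -> dist_topology dS -> dist_topology dT ->
  (forall x y, dT (j x) (j y) = dS x y) -> closed (range j) ->
  closed_embedding j.
Proof.
move=> dSP tS tT jd jcl; split=> //.
  by move=> x y xy; apply: (dist_eq0 dSP); rewrite -jd xy jd (distxx dSP).
move=> U; split=> [oU|[V oV ->]].
  (* The image of [U] with the whole complement of [range j] added: it pulls back to [U] and
     contains a ball around each point of that image. *)
  exists [set w | forall x, j x = w -> U x]°; first exact: open_interior.
  apply/seteqP; split=> [x Ux|x /interior_subset]; last exact.
  have /tS[e e0 eU] : nbhs x U by exact: open_nbhs_nbhs.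
  by apply/tT; exists e => // y xy x' jx'; apply: eU; rewrite -jd jx'.
apply: open_comp => // x _ W /tT[e e0 eW].
by apply/tS; exists e => // x'; rewrite -jd; exact: eW.
Qed.

Section set_dist.
Context {R : realType} {G : topologicalGroupType} {Y Z : gSpaceType G}.
Context {d : Z -> Z -> R} {i : Y -> Z}.
Hypothesis dP : is_dist d.
Hypothesis dT : dist_topology d.
Hypothesis dg : forall g x y, d (act g x) (act g y) = d x y.
Hypothesis i_map : g_map i.
Hypothesis i_closed : closed (range i).

Definition range_dist (z : Z) := inf (range (fun y => d z (i y))).

Lemma range_dist_le z y : range_dist z <= d z (i y).
Proof. by apply: (range_inf_le (c := 0)) => ?; exact: dist_ge0. Qed.

Lemma range_dist_act g z : range_dist (act g z) = range_dist z.
Proof.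
apply: (range_inf_map (v := act g) (v' := act g^-1%g)) => y.
  by rewrite -actM mulgV act1.
by rewrite i_map.2 dg.
Qed.

Lemma notin_range_act g z : ~ range i z -> ~ range i (act g z).
Proof.
move=> nz [y _ iy]; apply: nz; exists (act g^-1%g y) => //.
by rewrite i_map.2 iy -actM mulVg act1.
Qed.

Variable y0 : Y.

Lemma range_dist_ge0 z : 0 <= range_dist z.
Proof. by apply: range_inf_ge => // y; exact: dist_ge0. Qed.

Lemma range_dist_lip z z' : range_dist z' <= range_dist z + d z z'.
Proof.
rewrite -lerBlDr; apply: range_inf_ge => // y; rewrite lerBlDr.
rewrite (le_trans (range_dist_le _ y))// addrC (distC dP z).
exact: dist_triangle.
Qed.

Lemma range_dist_gt0 z : ~ range i z -> 0 < range_dist z.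
Proof.
move=> nz; have : nbhs z (~` range i).
  by apply: open_nbhs_nbhs; split=> //; exact: closed_openC.
move=> /dT[e e0 eP]; apply: lt_le_trans e0 _.
by apply: range_inf_ge => // y; rewrite leNgt; apply/negP => /eP; apply; exists y.
Qed.

Lemma range_dist_eq0 z : range_dist z = 0 <-> range i z.
Proof.
split=> [z0|[y _ <-]].
  by apply: contrapT => /range_dist_gt0; rewrite z0 ltxx.
apply/eqP; rewrite eq_le range_dist_ge0 andbT.
by rewrite (le_trans (range_dist_le _ y))// (distxx dP).
Qed.

Lemma range_dist_continuous : continuous (range_dist : Z -> R).
Proof.
move=> z; apply/cvgrPdist_lt => e e0; apply/dT; exists e => // z' zz'.
have := range_dist_lip z z'; have := range_dist_lip z' z.
rewrite (distC dP z') ltr_norml; lra.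
Qed.

(** Almost closest points exist: off the closed range the infimum is positive, so the factor [1 + e]
    enlarges it strictly. *)
Lemma range_dist_near z e : ~ range i z -> 0 < e ->
  exists y, d z (i y) / range_dist z - 1 < e.
Proof.
move=> /range_dist_gt0 z0 e0.
have [||y yP] := @range_inf_lt _ _ (fun y => d z (i y)) (range_dist z * (1 + e)).
- exact: y0.
- by rewrite ltr_pMr// ltrDl.
- by exists y; rewrite ltrBlDl ltr_pdivrMr// mulrC.
Qed.

End set_dist.

(** * The glued space and its invariant metric *)

Section gluing.
Context {R : realType} {G : topologicalGroupType} {X Y Z : gSpaceType G}.
Context {dX : X -> X -> R} {dZ : Z -> Z -> R} {i : Y -> Z} {f : Y -> X}.
Hypothesis dXP : is_dist dX.
Hypothesis dXT : dist_topology dX.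
Hypothesis dX1 : forall x y, dX x y <= 1.
Hypothesis dXg : forall g x y, dX (act g x) (act g y) = dX x y.
Hypothesis dZP : is_dist dZ.
Hypothesis dZT : dist_topology dZ.
Hypothesis dZ1 : forall x y, dZ x y <= 1.
Hypothesis dZg : forall g x y, dZ (act g x) (act g y) = dZ x y.
Hypothesis i_map : g_map i.
Hypothesis i_emb : closed_embedding i.
Hypothesis f_map : g_map f.
Variable y0 : Y.

Let i_closed : closed (range i). Proof. by case: i_emb. Qed.

Local Notation lam := (@range_dist R G Y Z dZ i).

Let lam1 z : lam z <= 1.
Proof. exact: le_trans (range_dist_le dZP z y0) (dZ1 _ _). Qed.

(** The part [dZ z (i y) / lam z - 1] is a penalty: off [range i] it is nonnegative, and arbitrarily
    small at almost closest [y]. *)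
Definition dist_ext_term (z : Z) (x : X) (y : Y) :=
  dX x (f y) + dZ z (i y) / lam z - 1.

(* Hausdorff's formula for the Tietze extension over Z of the function
   [fun y => dX x (f y)] on Y; since [lam z = 0] on Y, where the division gives
   0, it is only meaningful off Y. *)
Definition dist_ext (z : Z) (x : X) := inf (range (dist_ext_term z x)).

Let term_ge z x y : ~ range i z -> dX x (f y) <= dist_ext_term z x y.
Proof.
move=> nz; rewrite /dist_ext_term -addrA lerDl subr_ge0.
by rewrite ler_pdivlMr ?mul1r ?(range_dist_le dZP)// (range_dist_gt0 dZT i_closed y0).
Qed.

Let term_ge0 z x y : ~ range i z -> 0 <= dist_ext_term z x y.
Proof. by move=> nz; rewrite (le_trans _ (term_ge _ _ nz))// dist_ge0. Qed.

Let ext_le z x y : ~ range i z -> dist_ext z x <= dist_ext_term z x y.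
Proof. by move=> nz; apply: (range_inf_le (c := 0)) => ?; exact: term_ge0. Qed.

Lemma dist_ext01 z x : ~ range i z -> 0 <= dist_ext z x <= 1.
Proof.
move=> nz; apply/andP; split.
  by apply: range_inf_ge => // y; exact: term_ge0.
apply/ler_addgt0Pl => e e0.
have [y yP] := range_dist_near dZT i_closed y0 nz e0.
rewrite (le_trans (ext_le x y nz))// /dist_ext_term -addrA addrC.
by rewrite lerD// ltW.
Qed.

Lemma dist_ext_act g z x : dist_ext (act g z) (act g x) = dist_ext z x.
Proof.
apply: (range_inf_map (v := act g) (v' := act g^-1%g)) => y.
  by rewrite -actM mulgV act1.
by rewrite /dist_ext_term f_map.2 i_map.2 dXg dZg range_dist_act.
Qed.

(** If [z] is within [r / 3] of [i y], a ratio below 2 forces [i y'] within [r] of [i y], so [f y']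
    is close to [f y]. All other [y'] have penalty at least 1 and cannot lower the infimum below
    [dX x (f y)]. *)
Lemma dist_ext_near_range y e : 0 < e -> exists2 r, 0 < r &
  forall z, ~ range i z -> dZ (i y) z < r ->
    forall x, `|dX x (f y) - dist_ext z x| <= e.
Proof.
move=> e0; have e2 : 0 < e / 2 by lra.
have [r r0 rP] := closed_embedding_dist i_emb dZT
  (f_map.1 y _ (nbhs_dist (f y) dXT e2)).
exists (r / 3); first lra.
move=> z nz yz x; have z0 := range_dist_gt0 dZT i_closed y0 nz.
have zr : lam z < r / 3.
  by rewrite (le_lt_trans (range_dist_le dZP z y))// (distC dZP).
have near2 y' : dZ z (i y') / lam z < 2 -> dX (f y) (f y') < e / 2.
  rewrite ltr_pdivrMr// => zy'; apply: rP.
  have := dist_triangle dZP z (i y) (i y'); lra.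
rewrite ler_norml; apply/andP; split.
  (* The bound 1 brings the ratio below 2; [e / 2] bounds the penalty itself. *)
  have m0 : 0 < Num.min 1 (e / 2) by rewrite lt_min ltr01.
  have [y' y'P] := range_dist_near dZT i_closed y0 nz m0.
  have /near2 yy' : dZ z (i y') / lam z < 2.
    by move: y'P; rewrite lt_min => /andP[]; lra.
  have := ext_le x y' nz; rewrite /dist_ext_term.
  have := dist_triangle dXP (f y) x (f y').
  by move: y'P; rewrite lt_min => /andP[]; lra.
rewrite lerBlDr -lerBlDl; apply: range_inf_ge => // y'.
have [/near2 yy'|] := ltP (dZ z (i y') / lam z) 2.
  have := term_ge x y' nz; have := dist_triangle dXP (f y') x (f y).
  rewrite (distC dXP (f y')); lra.
rewrite /dist_ext_term; have := dX1 x (f y).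
have := dist_ge0 x (f y') dXP; lra.
Qed.

Lemma dist_ext_off_range z e : ~ range i z -> 0 < e -> exists2 r, 0 < r &
  forall z', dZ z z' < r ->
    ~ range i z' /\ forall x, `|dist_ext z x - dist_ext z' x| <= e.
Proof.
move=> nz e0; have z0 := range_dist_gt0 dZT i_closed y0 nz.
set L := lam z in z0.
have L2 : 0 < L ^+ 2 by rewrite exprn_gt0.
(* The first bound gives [M >= L / 2], so [z'] stays off the range; then [L * M >= L ^+ 2 / 2], and
   the second bound yields [LMe]. *)
exists (Num.min (L / 2) (e * L ^+ 2 / 4)).
  by rewrite lt_min !divr_gt0 ?mulr_gt0.
move=> z'; rewrite lt_min => /andP[zz' zz'e].
have nz' : ~ range i z'.
  move=> /(range_dist_eq0 dZP dZT i_closed y0) z'0.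
  have := range_dist_lip (i := i) dZP y0 z' z; rewrite (distC dZP) z'0 -/L; lra.
split=> // x.
have z'0 := range_dist_gt0 dZT i_closed y0 nz'.
set M := lam z' in z'0.
have LM : M <= L + dZ z z' by exact: range_dist_lip.
have ML : L <= M + dZ z z' by rewrite (distC dZP); exact: range_dist_lip.
have M1 : M <= 1 by exact: lam1.
have LMe : 2 * dZ z z' <= e * (L * M).
  suff : e * L ^+ 2 / 2 <= e * (L * M) by lra.
  by rewrite expr2 -mulrA ler_pM2l// -mulrA ler_pM2l//; lra.
have key y : `|dist_ext_term z x y - dist_ext_term z' x y| <= e.
  have zz'0 := dist_ge0 z z' dZP.
  have := dist_lip z z' (i y) dZP; set a := dZ z (i y); set b := dZ z' (i y).
  have b0 : 0 <= b by exact: dist_ge0.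
  have b1 : b <= 1 by exact: dZ1.
  move=> ab.
  (* As [M] and [b] are at most 1, this numerator is at most [2 * dZ z z'], uniformly in [x] and
     [y]. *)
  have -> : dist_ext_term z x y - dist_ext_term z' x y =
      (M * (a - b) + b * (M - L)) / (L * M).
    by rewrite /dist_ext_term -/a -/b -/L -/M; field; rewrite !gt_eqF.
  have LM0 : 0 < L * M by rewrite mulr_gt0.
  rewrite normrM normfV (gtr0_norm LM0) ler_pdivrMr//.
  apply: le_trans LMe; rewrite (le_trans (ler_normD _ _))//.
  rewrite !normrM (gtr0_norm z'0) (ger0_norm b0) mulrDl mul1r lerD//.
    by rewrite (le_trans (ler_piMl _ M1)).
  by rewrite (le_trans (ler_piMl _ b1))// ler_norml; lra.
rewrite ler_norml; apply/andP; split.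
  suff : dist_ext z' x - e <= dist_ext z x by lra.
  apply: range_inf_ge => // y; have := key y; have := ext_le x y nz'.
  rewrite ler_norml; lra.
suff : dist_ext z x - e <= dist_ext z' x by lra.
apply: range_inf_ge => // y; have := key y; have := ext_le x y nz.
rewrite ler_norml; lra.
Qed.

Let invC : g_invariant (~` range i).
Proof. by move=> g z; exact: notin_range_act. Qed.

Definition glue_type : Type := (X + g_subspace invC)%type.

HB.instance Definition _ := Choice.copy glue_type (X + g_subspace invC)%type.

Let offP (w : g_subspace invC) : ~ range i (set_val w).
Proof. exact: (set_valP (w : set_type (~` range i))). Qed.

Definition glue_act (g : G) (p : glue_type) : glue_type :=
  match p with inl x => inl (act g x) | inr w => inr (act g w) end.

(* The coordinates against points of X recover the distance of X and extend it
   over Z; those against points w of Z separate the points off Y, being positive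
   at w and zero on X. *)
Definition glue_coord (p q : glue_type) : R :=
  match p, q with
  | inl x, inl x' => dX x x'
  | inl _, inr _ => 0
  | inr z, inl x => dist_ext (set_val z) x
  | inr z, inr w =>
      Num.max 0 (lam (set_val z) - dZ (set_val z) (set_val w))
  end.

Lemma glue_coord01 p q : 0 <= glue_coord p q <= 1.
Proof.
case: p q => [x|z] [x'|w] /=; rewrite ?lexx ?ler01//.
- by rewrite dX1 dist_ge0.
- exact: dist_ext01.
- rewrite le_max lexx ge_max ler01 /=.
  have := lam1 (set_val z); have := dist_ge0 (set_val z) (set_val w) dZP; lra.
Qed.

Lemma glue_coord_inj : injective glue_coord.
Proof.
have pos w : 0 < glue_coord (inr w) (inr w).
  rewrite /= (distxx dZP) subr0 lt_max (range_dist_gt0 dZT i_closed y0) ?orbT//.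
move=> [x|z] [x'|z'] pq.
- have := congr1 (@^~ (inl x')) pq.
  by rewrite /= (distxx dXP) => /(dist_eq0 dXP) ->.
- by have := pos z'; rewrite -pq /= ltxx.
- by have := pos z; rewrite pq /= ltxx.
(* Each point is tested against the other: positivity of [a] and [b] forces [a - e = b] and
   [b - e = a], so [e = 0]. *)
- congr inr; apply/val_inj/(dist_eq0 dZP).
  have := congr1 (@^~ (inr z')) pq; have := congr1 (@^~ (inr z)) pq.
  have := pos z; have := pos z'; rewrite /= !(distxx dZP) !subr0.
  rewrite (distC dZP (set_val z')).
  have := dist_ge0 (set_val z) (set_val z') dZP.
  set a := lam _; set b := lam _; set e := dZ _ _.
  case: (leP 0 a) => ?; case: (leP 0 b) => ?; case: (leP 0 (a - e)) => ?;
    case: (leP 0 (b - e)) => ? * ; lra.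
Qed.

Definition glue_dist := sup_dist glue_coord.

Lemma glue_distP : is_dist glue_dist.
Proof. exact: sup_distP glue_coord01 glue_coord_inj. Qed.

Lemma glue_dist_act g p q :
  glue_dist (glue_act g p) (glue_act g q) = glue_dist p q.
Proof.
apply: (sup_dist_map (v := glue_act g) (v' := glue_act g^-1%g)).
  by case=> x /=; rewrite -actM mulgV act1.
case=> [x|z] [x'|w] //=.
  by rewrite dist_ext_act.
by rewrite range_dist_act// dZg.
Qed.

(** Kuratowski's argument: the triangle inequality bounds every coordinate difference, and the
    coordinate at [x'] attains the bound. *)
Lemma glue_dist_inl x x' : glue_dist (inl x) (inl x') = dX x x'.
Proof.
apply/eqP; rewrite eq_le; apply/andP; split.
  apply: sup_dist_le => [|[x''|w] /=]; rewrite ?subrr ?normr0 ?dist_ge0//.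
  exact: dist_lip.
apply: le_trans (sup_dist_ge glue_coord01 (inl x') _ _).
by rewrite /= (distxx dXP) subr0 ler_norm.
Qed.

Definition glue_map (z : Z) : glue_type :=
  match pselect (range i z) with
  | left h => inl (f (s2val (cid2 h)))
  | right nz => inr (exist _ z (mem_set nz))
  end.

Lemma glue_map_in y : glue_map (i y) = inl (f y).
Proof.
rewrite /glue_map; case: pselect => [h|[]]; last by exists y.
by case: cid2 => y' _ /= /(let: And3 inj _ _ := i_emb in inj) ->.
Qed.

Lemma glue_map_off z (nz : ~ range i z) :
  glue_map z = inr (exist _ z (mem_set nz)).
Proof.
rewrite /glue_map; case: pselect => // nz'.
by congr inr; apply: val_inj.
Qed.

Lemma glue_map_act g z : glue_map (act g z) = glue_act g (glue_map z).
Proof.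
have [[y _ <-]|nz] := pselect (range i z).
  by rewrite -i_map.2 !glue_map_in f_map.2.
rewrite (glue_map_off nz) (glue_map_off (notin_range_act i_map nz)) /=.
by congr inr; apply: val_inj.
Qed.

Lemma glue_map_cont z e : 0 < e -> exists2 r, 0 < r &
  forall z', dZ z z' < r -> glue_dist (glue_map z) (glue_map z') < e.
Proof.
move=> e0; have e2 : 0 < e / 2 by lra.
(* A supremum only preserves weak inequalities, hence the margin. *)
suff [r r0 rP] : exists2 r, 0 < r & forall z', dZ z z' < r ->
    glue_dist (glue_map z) (glue_map z') <= e / 2.
  by exists r => // z' /rP; lra.
have [[y _ <-]|nz] := pselect (range i z).
  have [r1 r10 r1P] := dist_ext_near_range y e2.
  have [r2 r20 r2P] := closed_embedding_dist i_emb dZT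
    (f_map.1 y _ (nbhs_dist (f y) dXT e2)).
  (* For [z'] off the range, [r1] serves the coordinates against [X], and [e / 2] bounds [lam z'],
     hence those against [Z]; [r2] serves [z'] in the range. *)
  exists (Num.min (Num.min r1 r2) (e / 2)); first by rewrite !lt_min r10 r20.
  move=> z'; rewrite !lt_min => /andP[/andP[zr1 zr2] ze].
  have [[y' _ y'z']|nz'] := pselect (range i z').
    rewrite -y'z' !glue_map_in glue_dist_inl ltW//; apply: r2P.
    by rewrite y'z'.
  rewrite glue_map_in (glue_map_off nz').
  apply: sup_dist_le => [|[x|w] /=]; first lra.
    by rewrite (distC dXP); exact: r1P.
  rewrite sub0r normrN ger0_norm ?le_max ?lexx// ge_max (ltW e2) /=.
  have := range_dist_le (i := i) dZP z' y; have := dist_ge0 z' (set_val w) dZP.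
  rewrite (distC dZP z' (i y)); lra.
have [r1 r10 r1P] := dist_ext_off_range nz e2.
(* The coordinates against [Z] are 2-Lipschitz in [z], being built from two 1-Lipschitz
   functions. *)
exists (Num.min r1 (e / 4)); first by rewrite lt_min r10; lra.
move=> z'; rewrite lt_min => /andP[/r1P[nz' zz'] ze].
rewrite (glue_map_off nz) (glue_map_off nz').
apply: sup_dist_le => [|[x|w] /=]; [lra|exact: zz'|].
have := range_dist_lip (i := i) dZP y0 z z'.
have := range_dist_lip (i := i) dZP y0 z' z.
rewrite (distC dZP z' z); have := dist_lip z z' (set_val w) dZP.
move: (lam z) (lam z') (dZ z _) (dZ z' _) => a b c d'; rewrite !ler_norml.
by case: (leP 0 (a - c)) => ?; case: (leP 0 (b - d')) => ?; lra.
Qed.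

Lemma glue_act_isometric : is_isometric_action glue_dist glue_act.
Proof.
split.
- by case=> x /=; rewrite act1.
- by move=> g h [x|x] /=; rewrite actM.
- exact: glue_dist_act.
- move=> g [x|z] e e0.
    apply: (@filterS _ (nbhs g) _ _ _ _
      (@orbit_continuous _ _ x g _ (nbhs_dist (act g x) dXT e0))) => h /=.
    by rewrite glue_dist_inl.
  (* The orbit map of a point off [X] is an orbit map in [Z] followed by the equivariant [glue_map],
     so its continuity is inherited. *)
  have zE : inr z = glue_map (set_val z) :> glue_type.
    by rewrite (glue_map_off (@offP z)); congr inr; apply: val_inj.
  have [r r0 rP] := glue_map_cont (act g (set_val z)) e0.
  apply: (@filterS _ (nbhs g) _ _ _ _
    (@orbit_continuous _ _ (set_val z) g _ (nbhs_dist _ dZT r0))) => h.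
  by rewrite zE -!glue_map_act; exact: rP.
Qed.

Definition glue_space := dist_gspace glue_distP glue_act_isometric.

Lemma glue_spaceP : exists (W : gSpaceType G) (j : X -> W) (q : Z -> W),
  [/\ metrizable R W, g_map j, closed_embedding j, g_map q &
      forall y, q (i y) = j (f y)].
Proof.
pose W : gSpaceType G := glue_space.
have WT : dist_topology (glue_dist : W -> W -> R) by exact: dist_gspace_topology.
exists W, (inl : X -> glue_type), glue_map; split.
- by apply/metrizableP; exists glue_dist; [exact: glue_distP|].
- split=> //; apply/(dist_continuous _ dXT WT) => x e e0; exists e => // x'.
  by rewrite glue_dist_inl.
- apply: (isometric_closed_embedding dXP dXT WT) => //; first exact: glue_dist_inl.
  rewrite -openC openE => -[x nx|w _]; first by case: nx; exists x.
  (* The coordinate at [w] equals [lam] at [w] itself and vanishes on [X], so this ball misses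
     [X]. *)
  apply/WT; exists (lam (set_val w)).
    by rewrite (range_dist_gt0 dZT i_closed y0).
  move=> p wp [x _ xp]; move: wp; rewrite -xp ltNge => /negP; apply.
  apply: le_trans (sup_dist_ge glue_coord01 (inr w) _ _).
  by rewrite /= (distxx dZP) !subr0 (le_trans _ (ler_norm _))// le_max lexx orbT.
- split; last exact: glue_map_act.
  apply/(dist_continuous _ dZT WT) => z e e0; exact: glue_map_cont.
- exact: glue_map_in.
Qed.

End gluing.

(** * Extension of equivariant maps into a G-ANR, and the final retraction *)

Section subspace_maps.
Context {T X : topologicalType} (S : set X).

Lemma set_val_continuous : continuous (set_val : set_type S -> X).
Proof. exact: initial_continuous. Qed.

Lemma set_type_continuous (h : T -> set_type S) :
  continuous (fun t => set_val (h t)) -> continuous h.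
Proof. by move=> hc; apply/continuous_comp_initial. Qed.

End subspace_maps.

Lemma metrizable_subspace (R : realType) (G : topologicalGroupType)
    (X : gSpaceType G) (S : set X) (invS : g_invariant S) :
  metrizable R X -> metrizable R (g_subspace invS).
Proof.
move=> /metrizableP[d dP dT]; apply/metrizableP.
exists (fun a b => d (set_val a) (set_val b)).
  split=> [a|a b /(dist_eq0 dP)/val_inj//|a b|b a c].
  - exact: distxx dP _.
  - exact: distC dP _ _.
  - exact: dist_triangle dP _ _ _.
move=> a U; split=> [[_ [[V oV <-] Va] VU]|[e e0 eU]].
  have /dT[e e0 eV] : nbhs (set_val a) V by exact: open_nbhs_nbhs.
  by exists e => // b /eV Vb; exact: VU.
have ae := nbhs_dist (set_val a) dT e0.
apply: (@filterS _ (nbhs a) _ _ _ _ (@set_val_continuous X S a _ ae)) => b.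
exact: eU.
Qed.

Lemma g_anr_extension (R : realType) (G : topologicalGroupType)
    (X Y Z : gSpaceType G) (i : Y -> Z) (f : Y -> X) :
  compact [set: G] -> g_anr R X -> metrizable R Z ->
  g_map i -> closed_embedding i -> g_map f ->
  exists (U : set Z) (invU : g_invariant U) (h : g_subspace invU -> X),
    [/\ range i `<=` U°, g_map h &
        forall (y : Y) (u : g_subspace invU), set_val u = i y -> h u = f y].
Proof.
move=> cG [mX anrX] mZ i_map i_emb f_map.
(* For empty [Y] the empty neighborhood suffices; otherwise [y0] keeps the infima of the gluing over
   nonempty sets. *)
have [[y0]|Y0] := pselect (inhabited Y); last first.
  have inv0 : g_invariant (set0 : set Z) by [].
  have noU (u : g_subspace inv0) : False.
    exact: (set_valP (u : set_type set0)).
  exists set0, inv0, (fun u => False_rect X (noU u)); split.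
  - by move=> _ [y _ <-]; case: Y0.
  - by split=> [u|g u]; case: (noU u).
  - by move=> y u; case: (noU u).
have [dX [dXP dXT dX1 dXg]] := invariant_dist cG mX.
have [dZ [dZP dZT dZ1 dZg]] := invariant_dist cG mZ.
have [W [j [q [mW j_map j_emb q_map qi]]]] :=
  glue_spaceP dXP dXT dX1 dXg dZP dZT dZ1 dZg i_map i_emb f_map y0.
have [V [invV [r [jV r_map rj]]]] := anrX W j mW j_map j_emb.
have invU : g_invariant (q @^-1` V).
  by move=> g z /= Vqz; rewrite q_map.2; exact: (invV g _ Vqz).
pose k (u : g_subspace invU) : g_subspace invV :=
  exist _ (q (set_val u))
    (mem_set (set_valP (u : set_type (q @^-1` V)) : V (q (set_val u)))).
exists (q @^-1` V), invU, (r \o k); split.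
- by move=> _ [y _ <-]; apply: q_map.1; rewrite qi; apply: jV; exists (f y).
- split=> [u|g u].
    apply: continuous_comp; last exact: r_map.1.
    apply: set_type_continuous => {}u.
    apply: (@continuous_comp _ _ _ (set_val : g_subspace invU -> Z) q).
      exact: set_val_continuous.
    exact: q_map.1.
  rewrite /= -r_map.2; congr r; apply: val_inj.
  exact: q_map.2.
- by move=> y u uy; apply: rj; rewrite -qi -uy.
Qed.

Theorem proposition5p2 (R : realType) (G : topologicalGroupType)
  (compactG : compact [set: G]) (hausdorffG : hausdorff_space G)
  (X : gSpaceType G)
  (hausdorffX : hausdorff_space X) (regularX : completely_regular_space X)
  (A : set X) (invA : g_invariant A) (denseA : g_homotopy_dense R A) :
  g_anr R X -> g_anr R (g_subspace invA).
Proof.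
move=> anrX; split; first exact: metrizable_subspace anrX.1.
move=> Z i mZ i_map i_emb.
have [_ [F [[Fc Fg] F0 FA]]] := denseA.
have val_map : g_map (set_val : g_subspace invA -> X).
  by split=> //; exact: set_val_continuous.
have [U [invU [h [iU h_map hi]]]] :=
  g_anr_extension compactG anrX mZ i_map i_emb val_map.
have [d [dP dT d1 dg]] := invariant_dist compactG mZ.
exists U, invU.
(* If A is empty, then so are X and U. *)
have [[y0]|A0] := pselect (inhabited (g_subspace invA)); last first.
  have noU (u : g_subspace invU) : False.
    apply: A0; have t1 : 1 \in (`[0, 1]%classic : set R).
      by rewrite inE /= in_itv /= ler01 lexx.
    have /mem_set Ax : A (F (h u, exist _ 1 t1)) by apply: FA; exact: ltr01.
    by constructor; exists (F (h u, exist _ 1 t1)).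
  by exists (fun u => False_rect _ (noU u)).
have i_closed : closed (range i) by case: i_emb.
(* The bound [d1] makes this distance a legitimate homotopy time. *)
pose lam z := range_dist (d := d) (i := i) z.
have lam01 z : lam z \in (`[0, 1]%classic : set R).
  rewrite inE /= in_itv /= (range_dist_ge0 dP y0).
  exact: le_trans (range_dist_le dP z y0) (d1 _ _).
pose t z : unit_interval R := exist _ (lam z) (lam01 z).
have t_cont : continuous t.
  apply: set_type_continuous; exact: range_dist_continuous.
(* At time 0 the point lies in [range i], where [h] is the inclusion of [A]; at positive times the
   homotopy itself lands in [A]. *)
have rA (u : g_subspace invU) : A (F (h u, t (set_val u))).
  have := range_dist_ge0 (i := i) dP y0 (set_val u).
  rewrite le_eqVlt => /orP[/eqP/esym u0|u0]; last by apply: FA; exact: u0.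
  rewrite F0//; move: u0 => /(range_dist_eq0 dP dT i_closed y0)[y _ yu].
  by rewrite (hi y)//; exact: (set_valP (y : set_type A)).
exists (fun u => exist _ (F (h u, t (set_val u))) (mem_set (rA u))); split=> //.
- split=> [|g u].
    apply: set_type_continuous => u /=.
    apply: (@continuous_comp _ _ _
      (fun u : g_subspace invU => (h u, t (set_val u))) F); last exact: Fc.
    have tc : {for u, continuous (t \o (set_val : g_subspace invU -> Z))}.
      by apply: continuous_comp; [exact: set_val_continuous|exact: t_cont].
    exact: (cvg_pair (h_map.1 u) tc).
  apply: val_inj => /=; rewrite h_map.2 -Fg; congr (F (_, _)).
  (* Invariance of [d] makes the time constant on orbits. *)
  by apply: val_inj => /=; rewrite /lam range_dist_act.
- move=> y u uy; apply: val_inj => /=; rewrite F0 ?(hi y)//=.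
  by apply/(range_dist_eq0 dP dT i_closed y0); exists y.
Qed.
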